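(* Let $\mathbf{A}$ be a semilattice. Then the pair $\langle E(X(\mathbf{A})),\beta\rangle$ is a canonical extension of $\mathbf{A}$.
   Context: A semilattice is a meet-semilattice with top $\langle A,\wedge,1\rangle$. A filter is an upset containing $1$ closed under $\wedge$; a proper filter $F$ is irreducible if $F=F_1\cap F_2$ for filters $F_1,F_2$ implies $F=F_1$ or $F=F_2$. $X(\mathbf{A})$ is the set of irreducible filters, $\beta(a)=\{P\in X(\mathbf{A})\colon a\in P\}$, and $X(\mathbf{A})$ carries the topology with subbase $\mathcal{K}_\mathbf{A}=\{\beta(a)^c\colon a\in A\}$. A subset $Z\subseteq X(\mathbf{A})$ is subbasic saturated if $Z=\bigcap\mathcal{L}$ for some dually directed family $\mathcal{L}\subseteq\mathcal{K}_\mathbf{A}$ (for $U,V\in\mathcal{L}$ there is $W\in\mathcal{L}$, $W\subseteq U\cap V$); $\mathcal{Z}(X(\mathbf{A}))$ denotes their set. $E(X(\mathbf{A}))=\{\bigcap\{U^c\colon U\in\mathcal{B}\}\colon \mathcal{B}\subseteq\mathcal{Z}(X(\mathbf{A}))\}$, a complete lattice under inclusion. An order-ideal is a nonempty directed downset. A completion of $\mathbf{A}$ is a pair $\langle E,e\rangle$ with $E$ a complete lattice and $e\colon A\to E$ a semilattice embedding. $x\in E$ is closed if $x=\bigwedge e[F]$ for some filter $F$, open if $x=\bigvee e[I]$ for some order-ideal $I$. The completion is dense if every $x\in E$ is the meet of the open elements above it and the join of the closed elements below it; it is compact if whenever $D\subseteq A$ is nonempty dually directed, $U\subseteq A$ nonempty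 directed, and $\bigwedge e[D]\le\bigvee e[U]$, there are $x\in D$, $y\in U$ with $x\le y$. A canonical extension is a dense compact completion. *)

(* Defs.v *)
From HB Require Import structures.
From mathcomp Require Import all_boot all_order.
From mathcomp Require Import boolp classical_sets.

Set Implicit Arguments.
Unset Strict Implicit.
Unset Printing Implicit Defensive.

Import Order.TTheory.
Local Open Scope order_scope.
Local Open Scope classical_set_scope.

Section OrderedSets.
Context {d : Order.disp_t} {T : porderType d}.
Implicit Types S : set T.

Definition is_upset S := forall x y, S x -> x <= y -> S y.

Definition is_downset S := forall x y, S y -> x <= y -> S x.

(* The empty set is both directed and dually directed; nonemptiness is required
   separately where it is needed. *)
Definition directed S :=
  forall x y, S x -> S y -> exists z, [/\ S z, x <= z & y <= z].

Definition dually_directed S :=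
  forall x y, S x -> S y -> exists z, [/\ S z, z <= x & z <= y].

Definition order_ideal S := [/\ S !=set0, directed S & is_downset S].

End OrderedSets.

Definition is_complete_lattice {d : Order.disp_t} (E : porderType d) :=
  forall S : set E, infimums S !=set0 /\ supremums S !=set0.

Section Semilattices.
Context {d : Order.disp_t} {A : tMeetSemilatticeType d}.
Implicit Types F P : set A.

Definition sl_filter F :=
  [/\ is_upset F, F \top & forall x y, F x -> F y -> F (Order.meet x y)].

Definition irreducible_filter P :=
  [/\ sl_filter P, P <> setT &
      forall F1 F2, sl_filter F1 -> sl_filter F2 ->
        P = F1 `&` F2 -> P = F1 \/ P = F2].

End Semilattices.

Section Completions.
Context {d d' : Order.disp_t} {A : tMeetSemilatticeType d} {E : porderType d'}.
Variable e : A -> E.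

(* Meets in [E] are expressed with [infimums]; the infimum of the empty set is
   the top of [E]. *)
Definition semilattice_embedding :=
  [/\ injective e,
      forall a b, infimums [set e a; e b] (e (Order.meet a b)) &
      infimums set0 (e \top)].

Definition is_completion := is_complete_lattice E /\ semilattice_embedding.

Definition closed_element (x : E) :=
  exists2 F : set A, sl_filter F & infimums (e @` F) x.

Definition open_element (x : E) :=
  exists2 I : set A, order_ideal I & supremums (e @` I) x.

Definition dense_completion :=
  forall x : E,
    infimums [set y | open_element y /\ x <= y] x /\
    supremums [set y | closed_element y /\ y <= x] x.

Definition compact_completion :=
  forall D U : set A,
    D !=set0 -> dually_directed D -> U !=set0 -> directed U ->
    forall m j : E, infimums (e @` D) m -> supremums (e @` U) j -> m <= j ->
    exists x y, [/\ D x, U y & x <= y].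

Definition canonical_extension :=
  [/\ is_completion, dense_completion & compact_completion].

End Completions.

Section DualSpace.
Context {d : Order.disp_t} (A : tMeetSemilatticeType d).

Definition irr_space := set_type [set P : set A | irreducible_filter P].

Definition beta_set (a : A) : set irr_space := [set P | val P a].

Definition subbase : set (set irr_space) :=
  [set U | exists a : A, U = ~` beta_set a].

(* [dually_directed] refers here to the canonical order on [set irr_space],
   which is inclusion. *)
Definition subbasic_saturated : set (set irr_space) :=
  [set Z | exists L : set (set irr_space),
     [/\ L `<=` subbase, dually_directed L & Z = \bigcap_(U in L) U]].

Definition E_sets : set (set irr_space) :=
  [set Y | exists2 B : set (set irr_space),
     B `<=` subbasic_saturated & Y = \bigcap_(U in B) ~` U].

Definition E_space := set_type E_sets.

HB.instance Definition _ := SubChoice.on E_space.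
HB.instance Definition _ := [SubChoice_isSubPOrder of E_space by <: with set_display].

Lemma E_space_leP (Y Y' : E_space) : (Y <= Y') <-> (val Y `<=` val Y').
Proof. by split => [/asboolP|?]; last exact/asboolP. Qed.

Lemma beta_setE (a : A) : beta_set a \in E_sets.
Proof.
rewrite inE; exists [set ~` beta_set a]; last by rewrite bigcap_set1 setCK.
move=> _ ->; exists [set ~` beta_set a].
split; first by move=> _ ->; exists a.
- by move=> _ _ -> ->; exists (~` beta_set a).
- by rewrite bigcap_set1.
Qed.

Definition beta (a : A) : E_space := Sub (beta_set a) (beta_setE a).

End DualSpace.

(* Main.v *)
Require Import Defs.
From mathcomp Require Import all_boot all_order.
From mathcomp Require Import boolp classical_sets.

(** By Zorn's lemma, a filter disjoint from a nonempty directed set [U] extends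
    to a filter that is maximal among those disjoint from [U], and such a filter
    is irreducible: two strictly larger filters meet [U] in points [a] and [b],
    and an upper bound of [a] and [b] in [U] lies in both.  This separation gives
    compactness and the injectivity of [beta].

    Meets in [E_space A] are intersections, and the join of [beta @` U] is the
    union of the [beta a] whenever [U] is directed, because the complement of
    that union is subbasic saturated.  Hence the elements of [E_space A] are the
    intersections of open elements.  They are also up-closed for inclusion of
    irreducible filters, so each is the union of the closed elements
    [{Q | P `<=` Q}] generated by its points [P]. *)

Set Implicit Arguments.
Unset Strict Implicit.
Unset Printing Implicit Defensive.

Import Order.TTheory.
Local Open Scope order_scope.
Local Open Scope classical_set_scope.

(** * Filters maximal among those avoiding a directed set *)

Section Filters.
Context {d : Order.disp_t} {A : tMeetSemilatticeType d}.
Implicit Types F P I D U : set A.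

Lemma up_closure_filter D : D !=set0 -> dually_directed D ->
  sl_filter [set y | exists2 x, D x & x <= y].
Proof.
move=> [x0 Dx0] dirD; split=> [x y [z Dz zx] xy||x y [u Du ux] [v Dv vy]].
- by exists z => //; exact: le_trans zx xy.
- by exists x0 => //; exact: lex1.
- have [w [Dw wu wv]] := dirD u v Du Dv.
  by exists w; rewrite // lexI (le_trans wu ux) (le_trans wv vy).
Qed.

Lemma down_closure_ideal U : U !=set0 -> directed U ->
  order_ideal [set x | exists2 y, U y & x <= y].
Proof.
move=> [y0 Uy0] dirU; split=> [|x y [u Uu xu] [v Uv yv]|x y [u Uu yu] xy].
- by exists y0; exists y0.
- have [w [Uw uw vw]] := dirU u v Uu Uv.
  exists w; split; first by exists w.
  + exact: le_trans xu uw.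
  + exact: le_trans yv vw.
- by exists u => //; exact: le_trans xy yu.
Qed.

(** Only closure under meets uses that [C] is a chain: of two members of [C], the larger one
    contains both points. *)
Lemma filter_union_chain F (C : set (set A)) : sl_filter F ->
  (forall X, C X -> sl_filter (F `|` X)) -> total_on C subset ->
  sl_filter (F `|` \bigcup_(X in C) X).
Proof.
move=> [Fup F1 FI] Cfil Ctot.
have sub X : C X -> F `|` X `<=` F `|` \bigcup_(X in C) X.
  by move=> CX; apply: setUS; exact: bigcup_sup.
split=> [x y [Fx|[X CX Xx]] xy||x y [Fx|[X CX Xx]] [Fy|[Y CY Yy]]].
- by left; exact: Fup xy.
- by have [Xup _ _] := Cfil X CX; apply: (sub X CX); apply: Xup xy; right.
- by left.
- by left; exact: FI.
- by have [_ _ XI] := Cfil Y CY; apply: (sub Y CY); apply: XI; [left|right].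
- by have [_ _ XI] := Cfil X CX; apply: (sub X CX); apply: XI; [right|left].
- case: (Ctot X Y CX CY) => [XY|YX].
  + have [_ _ YI] := Cfil Y CY; apply: (sub Y CY); apply: YI; right => //.
    exact: XY.
  + have [_ _ XI] := Cfil X CX; apply: (sub X CX); apply: XI; right => //.
    exact: YX.
Qed.

Lemma maximal_disjoint_filter F U : sl_filter F -> F `&` U = set0 ->
  exists P, [/\ sl_filter P, F `<=` P, P `&` U = set0 &
    forall G, sl_filter G -> P `<=` G -> G `&` U = set0 -> P = G].
Proof.
move=> Ffil /disjoints_subset FU.
(* The union of the empty chain is [set0], hence the [F `|` _]. *)
pose Q := [set X | sl_filter (F `|` X) /\ F `|` X `<=` ~` U].
have [C CQ Ctot|X [[Xfil XU] Xmax]] := @Zorn_bigcup A Q.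
  split; first by apply: filter_union_chain => // X /CQ[].
  move=> x [/FU//|[X /CQ[_ XU] Xx]].
  by apply: XU; right.
exists (F `|` X); split => // [|G Gfil XG /disjoints_subset GU].
  exact/disjoints_subset.
apply/seteqP; split=> // x Gx; apply: contrapT => FXx.
have FGE : F `|` G = G by apply/setUidPr => y Fy; apply: XG; left.
apply: (Xmax G); last by split; rewrite FGE.
split=> [y Xy|GX]; first by apply: XG; right.
by apply: FXx; right; exact: GX.
Qed.

Lemma irreducible_filter_separation F U :
  sl_filter F -> U !=set0 -> directed U -> F `&` U = set0 ->
  exists P, [/\ irreducible_filter P, F `<=` P & P `&` U = set0].
Proof.
move=> Ffil [u Uu] dirU /(maximal_disjoint_filter Ffil)[P [Pfil FP PU Pmax]].
have PUF a : P a -> U a -> False.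
  by move=> Pa Ua; have : (P `&` U) a by []; rewrite PU.
exists P; split => //; split => // [PT|F1 F2 F1fil F2fil PE].
  by apply: (PUF u); rewrite ?PT.
apply: contrapT => /not_orP[PF1 PF2].
have meets G : sl_filter G -> P `<=` G -> P <> G -> G `&` U !=set0.
  by move=> Gfil PG PnG; apply/set0P/eqP => GU; apply: PnG; exact: Pmax.
have [|a [F1a Ua]] := meets F1 F1fil _ PF1.
  by rewrite PE; apply: subIsetl.
have [|b [F2b Ub]] := meets F2 F2fil _ PF2.
  by rewrite PE; apply: subIsetr.
have [c [Uc ac bc]] := dirU a b Ua Ub.
have [F1up _ _] := F1fil; have [F2up _ _] := F2fil.
by apply: (PUF c) => //; rewrite PE; split; [exact: F1up ac|exact: F2up bc].
Qed.

End Filters.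

(** * Separation of points and subbasic saturated sets in the dual space *)

Section DualSpace.
Context {d : Order.disp_t} {A : tMeetSemilatticeType d}.
Implicit Types (D U : set A) (P Q : irr_space A) (Y : E_space A).

Lemma irr_spaceP P : irreducible_filter (val P).
Proof. exact: set_mem (valP P). Qed.

(** If no element of [D] is below an element of [U], the filter generated by [D] misses [U], and an
    irreducible filter separating the two lies in the intersection but not in the union. *)
Lemma irr_space_separation D U :
  D !=set0 -> dually_directed D -> U !=set0 -> directed U ->
  \bigcap_(a in D) beta_set a `<=` \bigcup_(a in U) beta_set a ->
  exists x y, [/\ D x, U y & x <= y].
Proof.
move=> D0 dirD U0 dirU DU; apply: contrapT => nle.
have Ffil := up_closure_filter D0 dirD.
have [|P [Pirr FP PU]] := irreducible_filter_separation Ffil U0 dirU.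
  apply/disjoints_subset => y [x Dx xy] Uy; apply: nle.
  by exists x; exists y.
have [a Da|b Ub Pb] := DU (SigSub (mem_set Pirr)).
  by apply: FP; exists a.
by have : (P `&` U) b by []; rewrite PU.
Qed.

(** Left to right is separation for the singletons of [a] and [b]; the converse holds because points
    are upsets. *)
Lemma beta_set_subset (a b : A) : (beta_set a `<=` beta_set b) <-> (a <= b).
Proof.
split=> [ab|ab P Pa]; last first.
  by have [[Pup _ _] _ _] := irr_spaceP P; exact: Pup ab.
have dir1 (c : A) : directed [set c] /\ dually_directed [set c].
  by split=> _ _ -> ->; exists c.
have [|||||x [y [-> -> //]]] := @irr_space_separation [set a] [set b].
- by exists a.
- exact: (dir1 a).2.
- by exists b.
- exact: (dir1 b).1.
- by rewrite bigcap_set1 bigcup_set1.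
Qed.

Lemma subbasic_saturated_directed U : directed U ->
  subbasic_saturated (~` \bigcup_(a in U) beta_set a).
Proof.
move=> dirU; exists [set ~` beta_set a | a in U].
split; [by move=> _ [a _ <-]; exists a| |by rewrite bigcap_image setC_bigcup].
move=> _ _ [a Ua <-] [b Ub <-]; have [c [Uc ac bc]] := dirU a b Ua Ub.
exists (~` beta_set c); split; first by exists c.
- by apply/subsetPset/subsetC/beta_set_subset.
- by apply/subsetPset/subsetC/beta_set_subset.
Qed.

(** [U] collects all indices of members of [L], and inclusions between complements reverse the order
    of [A]. When [L] is empty so is [U], hence no nonemptiness is claimed. *)
Lemma subbasic_saturatedP (Z : set (irr_space A)) : subbasic_saturated Z ->
  exists2 U, directed U & Z = ~` \bigcup_(a in U) beta_set a.
Proof.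
move=> [L [Lsub Ldir ->]]; exists [set a | L (~` beta_set a)].
  move=> a b La Lb; have [W [LW Wa Wb]] := Ldir _ _ La Lb.
  have [c WE] := Lsub W LW; rewrite WE in LW Wa Wb.
  move: Wa Wb => /subsetPset; rewrite setCS => /beta_set_subset ac.
  by move=> /subsetPset; rewrite setCS => /beta_set_subset bc; exists c.
apply/seteqP; split=> [P LP [a La Pa]|P LP W LW]; first exact: LP La Pa.
have [a WE] := Lsub W LW; rewrite WE in LW *.
by move=> Pa; apply: LP; exists a.
Qed.

(** * Meets and directed joins in [E_space A] *)

Lemma E_sets_bigcup U : directed U -> E_sets (\bigcup_(a in U) beta_set a).
Proof.
move=> /subbasic_saturated_directed sat.
exists [set ~` \bigcup_(a in U) beta_set a]; first by move=> _ ->.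
by rewrite bigcap_set1 setCK.
Qed.

Lemma E_sets_bigcap (S : set (E_space A)) : E_sets (\bigcap_(Y in S) val Y).
Proof.
(* Taking every saturated set disjoint from some member of [S] avoids choosing a defining family for
   each member. *)
exists [set Z | subbasic_saturated Z /\ exists2 Y, S Y & val Y `<=` ~` Z].
  by move=> Z [].
apply/seteqP; split=> [P SP Z [_ [Y SY YZ]]|P SP Y SY]; first exact/YZ/SP.
have [B Bsat YE] := set_mem (valP Y); rewrite /= YE => Z BZ.
apply: SP; split; [exact: Bsat|exists Y => //].
by rewrite YE; exact: bigcap_inf.
Qed.

Definition E_inf (S : set (E_space A)) : E_space A :=
  SigSub (mem_set (E_sets_bigcap S)).

Lemma infimums_E_inf S : infimums S (E_inf S).
Proof.
split=> [Y SY|Y lbY]; apply/E_space_leP; first exact: bigcap_inf.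
by move=> P YP Y' /lbY/E_space_leP; apply.
Qed.

Lemma complete_E_space : is_complete_lattice (E_space A).
Proof.
move=> S; split; first by exists (E_inf S); exact: infimums_E_inf.
have [lb glb] := infimums_E_inf (ubound S).
exists (E_inf (ubound S)); split=> // Y SY.
by apply: glb => Y' ubY'; exact: ubY'.
Qed.

(** [Y] is an intersection of unions of sets [beta_set a], and membership in [beta_set a] survives
    enlarging the filter. *)
Lemma E_space_up_closed Y P Q : val Y P -> val P `<=` val Q -> val Y Q.
Proof.
have [B Bsat YE] := set_mem (valP Y); rewrite /= YE => YP PQ Z BZ.
have [U _ ZE] := subbasic_saturatedP (Bsat Z BZ).
have := YP Z BZ; rewrite ZE !setCK => -[a Ua Pa].
by exists a => //; exact: PQ.
Qed.

Definition beta_join U (dirU : directed U) : E_space A :=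
  SigSub (mem_set (E_sets_bigcup dirU)).

Lemma supremums_beta_join U (dirU : directed U) :
  supremums (@beta d A @` U) (beta_join dirU).
Proof.
split=> [_ [a Ua <-]|Y ubY]; apply/E_space_leP => P; first by exists a.
move=> [a Ua Pa]; have /E_space_leP : beta a <= Y by apply: ubY; exists a.
exact.
Qed.

(** Each [beta_set x] added by the down-closure lies in some [beta_set y] with [y] in [U]. This
    makes joins over nonempty directed sets open, although openness asks for an ideal. *)
Lemma val_beta_join_down_closure U (dirU : directed U)
    (dirI : directed [set x | exists2 y, U y & x <= y]) :
  val (beta_join dirI) = val (beta_join dirU).
Proof.
apply/seteqP; split=> P [a Ia Pa]; last by exists a => //; exists a.
by case: Ia => b Ub /beta_set_subset ab; exists b => //; exact: ab.
Qed.

Lemma open_element_beta_join U (dirU : directed U) :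
  U !=set0 -> open_element (@beta d A) (beta_join dirU).
Proof.
move=> U0; have I := down_closure_ideal U0 dirU.
exists [set x | exists2 y, U y & x <= y] => //; have [_ dirI _] := I.
suff -> : beta_join dirU = beta_join dirI by exact: supremums_beta_join.
by apply: val_inj; rewrite val_beta_join_down_closure.
Qed.

Lemma val_E_inf_beta D :
  val (E_inf (@beta d A @` D)) = \bigcap_(a in D) beta_set a.
Proof. exact: bigcap_image. Qed.

(** * Embedding, compactness and density *)

Lemma beta_embedding : semilattice_embedding (@beta d A).
Proof.
split=> [a b ab|a b|].
- have abE : beta_set a = beta_set b := congr1 val ab.
  by apply/le_anti/andP; split; apply/beta_set_subset; rewrite abE.
- split=> [Y [] -> |Y lbY]; apply/E_space_leP.
  + exact/beta_set_subset/leIl.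
  + exact/beta_set_subset/leIr.
  + move=> P YP; have [[_ _ PI] _ _] := irr_spaceP P.
    have /E_space_leP Ya : Y <= beta a by apply: lbY; left.
    have /E_space_leP Yb : Y <= beta b by apply: lbY; right.
    by apply: PI; [exact: Ya|exact: Yb].
- split=> [//|Y _]; apply/E_space_leP => P _.
  by have [[_ P1 _] _ _] := irr_spaceP P.
Qed.

Lemma beta_compact : compact_completion (@beta d A).
Proof.
move=> D U D0 dirD U0 dirU m j [_ glbm] [_ lubj] mj.
apply: irr_space_separation => //; rewrite -val_E_inf_beta.
(* [m] and [j] are known only by their universal properties; comparing them with the explicit meet
   and join turns [m <= j] into an inclusion of sets. *)
have /E_space_leP : E_inf (@beta d A @` D) <= beta_join dirU; last exact.
have [lbD _] := infimums_E_inf (@beta d A @` D).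
have [ubU _] := supremums_beta_join dirU.
exact: le_trans (glbm _ lbD) (le_trans mj (lubj _ ubU)).
Qed.

(** This is the nontrivial half of density by open elements, read pointwise: [Y] is the intersection
    of the complements of the sets [Z] in [B], and such a complement is an open element above [Y] as
    soon as its [U] is nonempty. *)
Lemma mem_open_elements_above Y P :
  (forall Y', open_element (@beta d A) Y' -> Y <= Y' -> val Y' P) -> val Y P.
Proof.
have [B Bsat YE] := set_mem (valP Y); rewrite /= => openP.
rewrite YE => Z BZ.
have [U dirU ZE] := subbasic_saturatedP (Bsat Z BZ); rewrite ZE setCK.
have YZ : Y <= beta_join dirU.
  apply/E_space_leP; rewrite /= YE -[X in _ `<=` X]setCK -ZE.
  exact: bigcap_inf.
have [U0|/set0P U0] := eqVneq U set0; last first.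
  exact: openP (open_element_beta_join dirU U0) YZ.
(* [U] may be empty, in which case [Y] is below every [beta a], and a proper
   filter omits some [a]. *)
exfalso; have [_ PT _] := irr_spaceP P; apply: PT; apply/seteqP; split=> // a _.
have dir1 : directed [set a] by move=> _ _ -> ->; exists a.
have [|b -> //] := openP _ (open_element_beta_join dir1 (ex_intro _ a erefl)).
apply: le_trans YZ _; apply/E_space_leP => Q [b].
by rewrite U0.
Qed.

Lemma beta_dense : dense_completion (@beta d A).
Proof.
move=> Y; split; split=> [Y' [_ //]|Y' bY]; apply/E_space_leP => P YP.
  apply: mem_open_elements_above => Y'' oY'' YY''.
  have /E_space_leP : Y' <= Y'' by apply: bY.
  exact.
(* As a set, [PE] consists of the points extending [P]: it contains [P], and it lies below [Y] by
   up-closure. *)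
pose PE := E_inf (@beta d A @` val P).
have /E_space_leP PY' : PE <= Y'.
  apply: bY; split; last apply/E_space_leP => Q.
    by exists (val P); [have [] := irr_spaceP P|exact: infimums_E_inf].
  by rewrite val_E_inf_beta => PQ; exact: E_space_up_closed YP PQ.
by apply: PY'; rewrite val_E_inf_beta.
Qed.

End DualSpace.

Theorem theorem6 (d : Order.disp_t) (A : tMeetSemilatticeType d) :
  canonical_extension (@beta d A).
Proof.
split; last exact: beta_compact.
- by split; [exact: complete_E_space|exact: beta_embedding].
- exact: beta_dense.
Qed.
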